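(* Let $\omega=\{\gamma_{ij}\}_{0\le i+j\le 6}$ be complex numbers with $\overline{\gamma_{ij}}=\gamma_{ji}$ and $\gamma_{00}>0$, and let $M(\omega)(3)$ be the associated moment matrix. Assume that $M(\omega)(3)\ge0$ and that its columns satisfy $Z^3=-aZ-b\bar Z$, where $a,b\in\mathbb{R}$ and $b<-a<2b$. Let $h(z,\bar z)=\bar z z^2-\bar z^2z-bz+b\bar z$, and let $\gamma=\{\gamma_{ij}\}_{i,j\ge0}$ be the recursive doubly indexed sequence (RDIS) with initial conditions $\{\gamma_{ij}\}_{0\le i\le j\le2}$ (taken from $\omega$) and characteristic polynomial $P(z,\bar z)=z^3+az+b\bar z$. Then the following are equivalent: (i) there exists a representing measure for $\omega$; (ii) there exists a representing measure for $\gamma$; (iii) $\Lambda_\omega(h)=0$ and $\Lambda_\omega(zh)=0$; (iv) $\operatorname{Im}\gamma_{12}=b\operatorname{Im}\gamma_{01}$ and $\gamma_{22}+2b\operatorname{Re}\gamma_{20}+(a-b)\gamma_{11}=0$; (v) $h\in\mathcal{P}_\gamma$; (vi) the columns of $M(\omega)(3)$ satisfy $\bar ZZ^2-\bar Z^2Z-bZ+b\bar Z=0$.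
   Context: $M(\omega)(3)$ is the matrix with rows and columns indexed by the monomials $\bar z^iz^j$, $i+j\le3$, whose entry in row $\bar z^kz^l$, column $\bar z^iz^j$ is $\gamma_{i+l,j+k}$; its column indexed by $\bar z^iz^j$ is denoted $\bar Z^iZ^j$. $\ge0$ means positive semidefinite. $\Lambda_\omega$ is the linear functional on polynomials in $z,\bar z$ of total degree $\le6$ with $\Lambda_\omega(\bar z^iz^j)=\gamma_{ij}$. A representing measure for a (finite or infinite) family $\{\gamma_{ij}\}$ is a positive Borel measure $\mu$ on $\mathbb{C}$ with $\gamma_{ij}=\int\bar z^iz^j\,d\mu$ for all indices $(i,j)$ of the family. The RDIS with initial conditions $\{\gamma_{ij}\}_{0\le i\le j\le s-1}$ and characteristic polynomial $z^s-\sum_{0\le l+k\le s-1}a_{lk}\bar z^lz^k$ is the (unique) sequence $\{\gamma_{ij}\}_{i,j\ge0}$ having these initial values and satisfying $\gamma_{ji}=\overline{\gamma_{ij}}$ and $\gamma_{i,j+s}=\sum_{0\le l+k\le s-1}a_{lk}\gamma_{i+l,j+k}$ for all $i,j\ge0$. $\mathcal{P}_\gamma$ is the set of characteristic polynomials of $\gamma$: all $p=\sum p_{lk}\bar z^lz^k$ ($z,\bar z$ commuting indeterminates) with $\sum p_{lk}\gamma_{i+l,j+k}=0$ for all $i,j\ge0$. *)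

(* Defs.v *)
From HB Require Import structures.
From mathcomp Require Import all_boot all_order all_algebra.
From mathcomp Require Import all_classical all_reals all_analysis.
From mathcomp Require Import complex.

Set Implicit Arguments.
Unset Strict Implicit.
Unset Printing Implicit Defensive.

Import Order.TTheory GRing.Theory Num.Theory.
Import numFieldNormedType.Exports.

Local Open Scope classical_set_scope.
Local Open Scope ring_scope.
Local Open Scope complex_scope.

(** Polynomials in the commuting indeterminates [z] and [zbar] are elements of
    [{poly {poly R[i]}}], [z] being the outer variable and [zbar] the inner
    one: the coefficient of [zbar ^+ l * z ^+ k] in [p] is [p`_k`_l]. *)
Section Polynomials.
Variable R : realType.

Definition pz : {poly {poly R[i]}} := 'X.
Definition pzbar : {poly {poly R[i]}} := 'X%:P.
Definition pconst (c : R[i]) : {poly {poly R[i]}} := c%:P%:P.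

End Polynomials.

Arguments pz {R}.
Arguments pzbar {R}.

(** A truncated family [{g_ij}_(i + j <= d)] is represented by a total function
    of which only the values at indices [i + j <= d] are ever used. *)
Section Moments.
Variable R : realType.
Implicit Types (g : nat -> nat -> R[i]) (p : {poly {poly R[i]}}).

(** The linear functional with [zbar ^+ l * z ^+ k |-> g l k]. *)
Definition Lambda g p : R[i] :=
  \sum_(k < size p) \sum_(l < size p`_k) p`_k`_l * g l k.

Definition charpolys g : set {poly {poly R[i]}} :=
  [set p : {poly {poly R[i]}} | forall i j : nat,
    \sum_(k < size p) \sum_(l < size p`_k)
      p`_k`_l * g (i + l)%N (j + k)%N = 0].

(** [g] is the recursive doubly indexed sequence with initial conditions
    [init i j], [i <= j <= s - 1], and characteristic polynomial [p]. *)
Definition is_RDIS (s : nat) (init : nat -> nat -> R[i]) p g : Prop :=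
  exists a : nat -> nat -> R[i],
    [/\ p = pz ^+ s - \sum_(l < s) \sum_(k < s | (l + k < s)%N)
                        pconst (a l k) * pzbar ^+ l * pz ^+ k,
        forall i j : nat, (i <= j < s)%N -> g i j = init i j,
        forall i j : nat, g j i = (g i j)^* &
        forall i j : nat,
          g i (j + s)%N = \sum_(l < s) \sum_(k < s | (l + k < s)%N)
                            a l k * g (i + l)%N (j + k)%N].

End Moments.

Section MomentMatrix.
Variable n : nat.

(** The pair [(i, j)] stands for the monomial [zbar ^+ i * z ^+ j]. *)
Definition mono : finType :=
  {ij : 'I_n.+1 * 'I_n.+1 | (ij.1 + ij.2 <= n)%N}.

Lemma mono_subproof (i j : nat) : (i + j <= n)%N ->
  ((inord i : 'I_n.+1) + (inord j : 'I_n.+1) <= n)%N.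
Proof.
move=> le_ijn; rewrite !inordK ?ltnS //.
  exact: leq_trans (leq_addl i j) le_ijn.
exact: leq_trans (leq_addr j i) le_ijn.
Qed.

Definition Mono (i j : nat) (le_ijn : (i + j <= n)%N) : mono :=
  exist _ (inord i, inord j) (mono_subproof le_ijn).

Variable R : realType.

Definition moment_mx (g : nat -> nat -> R[i]) : 'M[R[i]]_#|mono| :=
  \matrix_(r < #|mono|, c < #|mono|)
    let: (k, l) := val (enum_val r) in
    let: (i, j) := val (enum_val c) in
    g (i + l)%N (j + k)%N.

Definition moment_col (g : nat -> nat -> R[i]) (i j : nat)
    (le_ijn : (i + j <= n)%N) : 'cV[R[i]]_#|mono| :=
  col (enum_rank (Mono le_ijn)) (moment_mx g).

End MomentMatrix.

(** In the order of [R[i]], [0 <= x] also says that [x] is real. *)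
Definition psdmx (R : realType) (m : nat) (M : 'M[R[i]]_m) : Prop :=
  M \is hermsymmx /\
  forall v : 'cV[R[i]]_m, 0 <= ((map_mx Num.conj v)^T *m M *m v) 0 0.

Section Measures.
Variable R : realType.

(** [R[i]] with its Borel sigma-algebra; [R[i]^o] carries the norm topology. *)
Definition borelC := g_sigma_algebraType (open : set (set R[i]^o)).

Variable mu : {measure set borelC -> \bar R}.

Definition Cintegrable (f : borelC -> R[i]) : Prop :=
  mu.-integrable setT (fun z => (complex.Re (f z))%:E) /\
  mu.-integrable setT (fun z => (complex.Im (f z))%:E).

Definition Cintegral (f : borelC -> R[i]) : R[i] :=
  (\int[mu]_z complex.Re (f z))%R +i* (\int[mu]_z complex.Im (f z))%R.

(** [mu] represents the family of the [g i j] with [I i j]; without the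
    integrability clause [Cintegral] could take junk values. *)
Definition represents (I : nat -> nat -> Prop) (g : nat -> nat -> R[i]) : Prop :=
  forall i j : nat, I i j ->
    let m := fun z : R[i] => (z^*) ^+ i * z ^+ j in
    Cintegrable m /\ g i j = Cintegral m.

End Measures.

(* Main.v *)
Require Import Defs.
From HB Require Import structures.
From mathcomp Require Import all_boot all_order all_algebra.
From mathcomp Require Import all_classical all_reals all_analysis.
From mathcomp Require Import measurable_realfun complex.
From mathcomp Require Import ring lra zify.

Import Order.TTheory GRing.Theory Num.Theory.
Import numFieldNormedType.Exports.

Set Implicit Arguments.
Unset Strict Implicit.
Unset Printing Implicit Defensive.

Local Open Scope classical_set_scope.
Local Open Scope ring_scope.
Local Open Scope complex_scope.

(** Write [z = s + i t].  As [b < - a < 2 b], the zeros of [P] are the seven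
    points [0], [+-r], [+-x +- i y] with [4 x^2 = 2 b - a], [4 y^2 = 2 b + a] and
    [r^2 = - (a + b)], and [h = (z - zbar) (z zbar - b)] vanishes at all of them.
    A representing measure of [omega] integrates [|P|^2] to [0], hence lives on
    these points, whence (iii).  Conversely, modulo the ideal generated by [P]
    and its conjugate, [h] is determined by [h] and [z h], so (iii) makes [gamma]
    annihilate the ideal [(P, Pbar, h)] of the seven points; Lagrange
    interpolation then writes [gamma] as a combination of point evaluations, and
    testing the positive semidefinite [M(3)] on cubics that vanish at six of the
    seven points shows that the coefficients are nonnegative. *)

(** * Moment functionals and the recurrence *)

Section CoefSum.
Variables (A : nzRingType) (B : zmodType) (F : nat -> A -> B).
Hypothesis F_additive : forall k, zmod_morphism (F k).

Let F0 k : F k 0 = 0.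
Proof. by have := F_additive k 0 0; rewrite /= !subrr. Qed.

(** The range of summation depends on the polynomial, so two polynomials are compared over a common
    bound. The added terms vanish because an additive [F k] sends 0 to 0. *)
Lemma sum_coef_widen (p : {poly A}) (n : nat) : (size p <= n)%N ->
  \sum_(k < size p) F k p`_k = \sum_(k < n) F k p`_k.
Proof.
move=> le_pn; rewrite (big_ord_widen n (fun k => F k p`_k) le_pn).
rewrite [RHS](bigID (fun k : 'I_n => (k < size p)%N)) /= [X in _ + X]big1.
  by rewrite addr0.
by move=> k; rewrite -leqNgt => le_pk; rewrite nth_default // F0.
Qed.

Lemma sum_coefB (p q : {poly A}) :
  \sum_(k < size (p - q)) F k (p - q)`_k =
  \sum_(k < size p) F k p`_k - \sum_(k < size q) F k q`_k.
Proof.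
pose n := maxn (size (p - q)) (maxn (size p) (size q)).
rewrite !(sum_coef_widen (n := n)) ?leq_max ?leqnn ?orbT //.
by rewrite -sumrB; apply: eq_bigr => k _; rewrite coefB F_additive.
Qed.

Lemma sum_coef_monom (c : A) (m : nat) :
  \sum_(k < size (c *: 'X^m)) F k (c *: 'X^m)`_k = F m c.
Proof.
rewrite (sum_coef_widen (n := m.+1)); last first.
  by rewrite (leq_trans (size_scale_leq _ _)) // size_polyXn.
rewrite big_ord_recr /= big1 ?add0r => [|k _].
  by rewrite coefZ coefXn eqxx mulr1.
by rewrite coefZ coefXn ltn_eqF // mulr0 F0.
Qed.

End CoefSum.

Section LambdaTheory.
Variable R : realType.
Implicit Types (g : nat -> nat -> R[i]) (c : R[i]).

Lemma Lambda_inner_is_additive g k :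
  zmod_morphism (fun q : {poly R[i]} => \sum_(l < size q) q`_l * g l k).
Proof.
move=> p q; apply: (@sum_coefB _ _ (fun l x => x * g l k)) => l x y.
exact: mulrBl.
Qed.

Lemma Lambda_is_additive g : zmod_morphism (Lambda g).
Proof.
by move=> p q; apply: sum_coefB (Lambda_inner_is_additive g) p q.
Qed.

HB.instance Definition _ g := GRing.isZmodMorphism.Build _ _
  (Lambda g) (Lambda_is_additive g).

Lemma LambdaB g p q : Lambda g (p - q) = Lambda g p - Lambda g q.
Proof. exact: raddfB. Qed.

Lemma LambdaD g p q : Lambda g (p + q) = Lambda g p + Lambda g q.
Proof. exact: raddfD. Qed.

Lemma Lambda_sum g (I : Type) (s : seq I) (Q : pred I)
    (p : I -> {poly {poly R[i]}}) :
  Lambda g (\sum_(k <- s | Q k) p k) = \sum_(k <- s | Q k) Lambda g (p k).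
Proof. exact: raddf_sum. Qed.

Lemma Lambda_monom g c (l k : nat) :
  Lambda g (pconst c * pzbar ^+ l * pz ^+ k) = c * g l k.
Proof.
have -> : pconst c * pzbar ^+ l * pz ^+ k = (c *: 'X^l) *: 'X^k.
  by rewrite /pconst /pzbar /pz -polyC_exp -polyCM !mul_polyC.
rewrite /Lambda (sum_coef_monom (Lambda_inner_is_additive g)).
by apply: (@sum_coef_monom _ _ (fun l x => x * g l k)) => i x y; exact: mulrBl.
Qed.

End LambdaTheory.

Section MomentColumns.
Variables (R : realType) (n : nat).
Implicit Types g : nat -> nat -> R[i].

Lemma moment_colE g (i j k l : nat) (le_ij : (i + j <= n)%N)
    (le_kl : (k + l <= n)%N) :
  moment_col g le_ij (enum_rank (Mono le_kl)) 0 = g (i + l)%N (j + k)%N.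
Proof.
by rewrite /moment_col !mxE !enum_rankK /= !inordK //; lia.
Qed.

Lemma enum_rank_MonoP (r : 'I_#|mono n|) :
  exists k l (le_kl : (k + l <= n)%N), r = enum_rank (Mono le_kl).
Proof.
case E: (enum_val r) => [[k l] /= le_kl]; exists k, l, le_kl.
apply: enum_val_inj; rewrite enum_rankK E; apply: val_inj => /=.
by rewrite !inord_val.
Qed.

End MomentColumns.

(** * The recurrence of [P] and the moments of [h] *)

Section Recurrence.
Variables (R : realType) (a b : R).
Implicit Types (g omega gamma : nat -> nat -> R[i]) (h P : {poly {poly R[i]}}).

(** The coefficients supplied by [is_RDIS] are existential. Instead of identifying them, the
    functional of the shifted sequence is evaluated on both expressions of [P]: it vanishes on the
    first by the recurrence, and on the explicit one it yields the claim. *)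
Lemma RDIS_rec omega P gamma :
    P = pz ^+ 3 + pconst a%:C * pz + pconst b%:C * pzbar ->
    is_RDIS 3 omega P gamma ->
  forall i j : nat, gamma i j.+3 = - a%:C * gamma i j.+1 - b%:C * gamma i.+1 j.
Proof.
move=> PE [c [cE _ _ gammaE]] i j.
have monomE l k : Lambda (fun l k => gamma (i + l)%N (j + k)%N)
    (pzbar ^+ l * pz ^+ k) = gamma (i + l)%N (j + k)%N.
  have := Lambda_monom (fun l k => gamma (i + l)%N (j + k)%N) 1 l k.
  by rewrite /pconst !mul1r.
have : Lambda (fun l k => gamma (i + l)%N (j + k)%N) P = 0.
  have := monomE 0%N 3%N; rewrite expr0 mul1r addn0 => z3E.
  rewrite cE LambdaB z3E gammaE.
  apply/eqP; rewrite subr_eq0; apply/eqP.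
  rewrite Lambda_sum; apply: eq_bigr => l _; rewrite Lambda_sum.
  by apply: eq_bigr => k _; rewrite Lambda_monom.
have -> : P = pconst 1 * pzbar ^+ 0 * pz ^+ 3
    + pconst a%:C * pzbar ^+ 0 * pz ^+ 1 + pconst b%:C * pzbar ^+ 1 * pz ^+ 0.
  by rewrite PE /pconst; ring.
rewrite !LambdaD !Lambda_monom !(addn0, addn1, addn3) => E.
by apply/eqP; rewrite -subr_eq0 -E; apply/eqP; ring.
Qed.

(** Induction on the total degree: conjugation reduces to $i\le j$, and for $j\ge3$ the recurrence
    lowers the degree by two. The bound [N] lets the same argument serve truncated and infinite
    families. *)
Lemma rec_agree (N : nat) g g' :
    (forall i j : nat, (i + j <= N)%N -> (g i j)^* = g j i) ->
    (forall i j : nat, (i + j <= N)%N -> (g' i j)^* = g' j i) ->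
    (forall i j : nat, (i + j.+3 <= N)%N ->
       g i j.+3 = - a%:C * g i j.+1 - b%:C * g i.+1 j) ->
    (forall i j : nat, (i + j.+3 <= N)%N ->
       g' i j.+3 = - a%:C * g' i j.+1 - b%:C * g' i.+1 j) ->
    (forall i j : nat, (i <= j < 3)%N -> g i j = g' i j) ->
  forall i j : nat, (i + j <= N)%N -> g i j = g' i j.
Proof.
move=> g_conj g'_conj g_rec g'_rec gg' i j.
move: {2}(i + j)%N (erefl (i + j)%N) => n.
elim/ltn_ind: n i j => n IH.
suff H i j : (i + j = n)%N -> (i + j <= N)%N -> (i <= j)%N -> g i j = g' i j.
  move=> i j ijn le_ijN; case: (leqP i j) => [|/ltnW] le_ij; first exact: H.
  have le_jiN : (j + i <= N)%N by rewrite addnC.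
  by rewrite -(g_conj j i le_jiN) -(g'_conj j i le_jiN) (H j i) // addnC.
move=> ijn le_ijN le_ij.
case: (ltnP j 3) => [lt_j|le3j]; first by rewrite gg' ?le_ij.
have [k jE] : exists k, j = k.+3 by exists (j - 3)%N; rewrite -addn3 subnK.
rewrite {}jE in ijn le_ijN le_ij le3j *.
have lt1 : (i + k.+1 < n)%N by rewrite -ijn !addnS !ltnS leqW.
have lt2 : (i.+1 + k < n)%N by rewrite -ijn addSn !addnS !ltnS leqW.
rewrite g_rec // g'_rec //; congr (_ * _ - _ * _).
  by apply: (IH _ lt1) => //; rewrite (leq_trans (ltnW lt1)) // -ijn.
by apply: (IH _ lt2) => //; rewrite (leq_trans (ltnW lt2)) // -ijn.
Qed.

Lemma Lambda_hE h g :
    h = pzbar * pz ^+ 2 - pzbar ^+ 2 * pz - pconst b%:C * pz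
        + pconst b%:C * pzbar ->
  Lambda g h = g 1%N 2%N - g 2%N 1%N - b%:C * g 0%N 1%N + b%:C * g 1%N 0%N.
Proof.
move=> hE.
have -> : h = pconst 1 * pzbar ^+ 1 * pz ^+ 2 - pconst 1 * pzbar ^+ 2 * pz ^+ 1
    - pconst b%:C * pzbar ^+ 0 * pz ^+ 1 + pconst b%:C * pzbar ^+ 1 * pz ^+ 0.
  by rewrite hE /pconst; ring.
by rewrite !(LambdaB, LambdaD) !Lambda_monom !mul1r.
Qed.

Lemma Lambda_zhE h g :
    h = pzbar * pz ^+ 2 - pzbar ^+ 2 * pz - pconst b%:C * pz
        + pconst b%:C * pzbar ->
  Lambda g (pz * h) =
  g 1%N 3%N - g 2%N 2%N - b%:C * g 0%N 2%N + b%:C * g 1%N 1%N.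
Proof.
move=> hE.
have -> : pz * h =
    pconst 1 * pzbar ^+ 1 * pz ^+ 3 - pconst 1 * pzbar ^+ 2 * pz ^+ 2
    - pconst b%:C * pzbar ^+ 0 * pz ^+ 2 + pconst b%:C * pzbar ^+ 1 * pz ^+ 1.
  by rewrite hE /pconst; ring.
by rewrite !(LambdaB, LambdaD) !Lambda_monom !mul1r.
Qed.

Lemma charpolysE h g :
    h = pzbar * pz ^+ 2 - pzbar ^+ 2 * pz - pconst b%:C * pz
        + pconst b%:C * pzbar ->
  h \in charpolys g <-> forall i j : nat,
    g i.+1 j.+2 - g i.+2 j.+1 - b%:C * g i j.+1 + b%:C * g i.+1 j = 0.
Proof.
move=> hE.
have LE i j : Lambda (fun l k => g (i + l)%N (j + k)%N) h =
    g i.+1 j.+2 - g i.+2 j.+1 - b%:C * g i j.+1 + b%:C * g i.+1 j.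
  by rewrite (Lambda_hE _ hE) !(addn0, addn1, addn2).
rewrite inE /charpolys /=; split=> E i j; first by rewrite -LE; exact: E.
by rewrite -[LHS]/(Lambda (fun l k => g (i + l)%N (j + k)%N) h) LE.
Qed.

(* Modulo the ideal generated by [P] and its conjugate, [z * h = - zbar * h]
   and [z ^ 2 * h = (b - a) * h], so the two values of [h] and [z * h] decide. *)
Lemma h_moments_eq0 g :
    (forall i j : nat, g j i = (g i j)^*) ->
    (forall i j : nat, g i j.+3 = - a%:C * g i j.+1 - b%:C * g i.+1 j) ->
    let H i j := g i.+1 j.+2 - g i.+2 j.+1 - b%:C * g i j.+1
                 + b%:C * g i.+1 j in
  H 0%N 0%N = 0 -> H 0%N 1%N = 0 -> forall i j, H i j = 0.
Proof.
move=> g_conj g_rec H H00 H01.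
have g_rec' i j : g i.+3 j = - a%:C * g i.+1 j - b%:C * g i j.+1.
  by rewrite g_conj g_rec rmorphB !rmorphM rmorphN /= !oppr0 -!g_conj.
have Hcol i j : H i.+1 j = - H i j.+1.
  by rewrite /H g_rec' g_rec; ring.
have Hrow i j : H i j.+2 = (b - a)%:C * H i j.
  by rewrite rmorphB /= /H !g_rec !g_rec'; ring.
have H0 j : H 0%N j = 0.
  elim/ltn_ind: j => -[|[|j]] IH //.
  by rewrite Hrow IH ?mulr0.
by elim=> [|i IH] j //; rewrite Hcol IH oppr0.
Qed.

End Recurrence.

(** * Integration over the complex plane *)

Section ComplexIntegral.
Variables (R : realType) (mu : {measure set (borelC R) -> \bar R}).
Implicit Types (f q : borelC R -> R[i]) (c : R[i]).

Lemma CintegrableD f q :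
  Cintegrable mu f -> Cintegrable mu q -> Cintegrable mu (fun z => f z + q z).
Proof.
move=> [fR fI] [qR qI]; split.
- apply: eq_integrable (integrableD measurableT fR qR) => // z _.
  by rewrite /= -EFinD; congr (_%:E); case: (f z) (q z) => ? ? [].
- apply: eq_integrable (integrableD measurableT fI qI) => // z _.
  by rewrite /= -EFinD; congr (_%:E); case: (f z) (q z) => ? ? [].
Qed.

Lemma CintegralD f q : Cintegrable mu f -> Cintegrable mu q ->
  Cintegral mu (fun z => f z + q z) = Cintegral mu f + Cintegral mu q.
Proof.
move=> [fR fI] [qR qI]; apply/eqP; rewrite eq_complex /=.
apply/andP; split; apply/eqP; rewrite -RintegralD //; apply: eq_Rintegral => z _.
- by case: (f z) (q z) => ? ? [].
- by case: (f z) (q z) => ? ? [].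
Qed.

Lemma CintegrableZ c f :
  Cintegrable mu f -> Cintegrable mu (fun z => c * f z).
Proof.
case: c => x y [fR fI]; split.
- apply: eq_integrable (integrableB measurableT
    (integrableZl measurableT x fR) (integrableZl measurableT y fI)) => // z _.
  by rewrite /= -!EFinM -EFinB; congr (_%:E); case: (f z).
- apply: eq_integrable (integrableD measurableT
    (integrableZl measurableT x fI) (integrableZl measurableT y fR)) => // z _.
  by rewrite /= -!EFinM -EFinD; congr (_%:E); case: (f z).
Qed.

Lemma CintegralZ c f : Cintegrable mu f ->
  Cintegral mu (fun z => c * f z) = c * Cintegral mu f.
Proof.
case: c => x y [fR fI]; apply/eqP; rewrite eq_complex /=.
apply/andP; split; apply/eqP; rewrite -!RintegralZl //.
- rewrite -RintegralB //; last first.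
  - exact: (integrableZl measurableT y fI).
  - exact: (integrableZl measurableT x fR).
  by apply: eq_Rintegral => z _; case: (f z).
- rewrite -RintegralD //; last first.
  - exact: (integrableZl measurableT y fR).
  - exact: (integrableZl measurableT x fI).
  by apply: eq_Rintegral => z _; case: (f z).
Qed.

(** A nonnegative [f] with zero integral vanishes almost everywhere, hence so does [q]. This
    replaces any explicit statement about the support of [mu]. *)
Lemma Cintegral_vanish f q : Cintegrable mu f -> Cintegral mu f = 0 ->
    (forall z, 0 <= f z) -> Cintegrable mu q ->
    (forall z, f z = 0 -> q z = 0) ->
  Cintegral mu q = 0.
Proof.
move=> [fR _] [intfR _] f_ge0 [qR qI] fq0.
have Ref_ge0 z : 0 <= complex.Re (f z).
  by have := f_ge0 z; case: (f z) => x y /=; rewrite lecE /= => /andP[].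
have Ref_ae0 : ae_eq mu setT (fun z => (complex.Re (f z))%:E) (cst 0%E).
  apply/(ae_eq_integral_abs mu measurableT (measurable_int _ fR)).
  rewrite (eq_integral (fun z => (complex.Re (f z))%:E)); last first.
    by move=> z _; rewrite /= ger0_norm.
  by rewrite -[LHS]fineK ?integrable_fin_num // -/(Rintegral _ _ _) intfR.
(* The order of [R[i]] makes [f z] real, so its real part determines it. *)
have f0 z : complex.Re (f z) = 0 -> f z = 0.
  by have := f_ge0 z; case: (f z) => x y; rewrite lecE /= => /andP[/eqP-> _] ->.
rewrite /Cintegral /Rintegral.
rewrite (@ae_eq_integral _ _ _ mu setT (cst 0%E)) ?measurable_int //; last first.
- apply: filterS Ref_ae0 => z /[apply] /= -[/f0/fq0 ->].
  by [].
- exact: (measurable_int _ qR).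
rewrite integral0 (@ae_eq_integral _ _ _ mu setT (cst 0%E)) ?integral0 //.
- exact: (measurable_int _ qI).
- by apply: filterS Ref_ae0 => z /[apply] /= -[/f0/fq0 ->].
Qed.

End ComplexIntegral.

(** * Borel measurability of the monomials *)

Section BorelC.
Variable R : realType.

Lemma le_normr_complex (x y : R) :
  `|x|%:C <= `|x +i* y| /\ `|y|%:C <= `|x +i* y|.
Proof.
rewrite normc_def !lecR /= -!sqrtr_sqr; split; apply: ler_wsqrtr.
- by rewrite lerDl sqr_ge0.
- by rewrite lerDr sqr_ge0.
Qed.

Lemma continuous_Re : continuous (@complex.Re R : R[i]^o -> R).
Proof.
move=> z; apply/(@cvgrPdist_lt _ _ _ _ (nbhs_filter (z : R[i]^o))) => e e_gt0.
have e_gt0C : 0 < e%:C by rewrite ltcR.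
have := nbhsx_ballx (z : R[i]^o) e%:C e_gt0C; apply: filterS => w.
rewrite -ball_normE /= -ltcR; apply: le_lt_trans.
by case: z w => [x y] [u v] /=; have [] := le_normr_complex (x - u) (y - v).
Qed.

Lemma continuous_Im : continuous (@complex.Im R : R[i]^o -> R).
Proof.
move=> z; apply/(@cvgrPdist_lt _ _ _ _ (nbhs_filter (z : R[i]^o))) => e e_gt0.
have e_gt0C : 0 < e%:C by rewrite ltcR.
have := nbhsx_ballx (z : R[i]^o) e%:C e_gt0C; apply: filterS => w.
rewrite -ball_normE /= -ltcR; apply: le_lt_trans.
by case: z w => [x y] [u v] /=; have [] := le_normr_complex (x - u) (y - v).
Qed.

(** Open intervals generate the Borel sets of the line, and their preimages are open, hence among
    the generators of [borelC]. *)
Lemma measurable_continuous_borelC (f : R[i]^o -> R) :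
  continuous f -> measurable_fun [set: borelC R] (f : borelC R -> R).
Proof.
move=> /continuousP cf; apply: (measurability _ (RGenOpens.measurableE R)).
move=> _ [_ [x [y ->] <-]]; rewrite setTI.
apply: sub_sigma_algebra; apply: cf.
exact: interval_open.
Qed.

Lemma measurable_monomial (i j : nat) :
  measurable_fun [set: borelC R]
    (fun z : borelC R => complex.Re ((z^*) ^+ i * z ^+ j : R[i])) /\
  measurable_fun [set: borelC R]
    (fun z : borelC R => complex.Im ((z^*) ^+ i * z ^+ j : R[i])).
Proof.
(* Coordinatewise measurability is stable under products, so only [z] and its conjugate need to be
   checked. *)
pose measC (f : borelC R -> R[i]) := measurable_fun setT (@complex.Re R \o f) /\
  measurable_fun setT (@complex.Im R \o f).
have measM f g : measC f -> measC g -> measC (fun z => f z * g z).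
  move=> [fR fI] [gR gI]; split.
  - rewrite (_ : _ \o _ = (fun z => complex.Re (f z) * complex.Re (g z)
        - complex.Im (f z) * complex.Im (g z))).
      by apply: measurable_funB; apply: measurable_funM.
    by apply/funext => z /=; case: (f z) (g z) => ? ? [].
  - rewrite (_ : _ \o _ = (fun z => complex.Re (f z) * complex.Im (g z)
        + complex.Im (f z) * complex.Re (g z))).
      by apply: measurable_funD; apply: measurable_funM.
    by apply/funext => z /=; case: (f z) (g z) => ? ? [].
have measX f n : measC f -> measC (fun z => f z ^+ n).
  move=> mf; elim: n => [|n IHn].
    by split; apply: measurable_cst.
  rewrite (_ : (fun z => _) = (fun z => f z * f z ^+ n)); first exact: measM.
  by apply/funext => z; rewrite exprS.
have mR := measurable_continuous_borelC continuous_Re.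
have mI := measurable_continuous_borelC continuous_Im.
apply: measM; apply: measX; split => //.
- rewrite (_ : _ \o _ = (@complex.Re R : borelC R -> R)) //.
  by apply/funext => -[].
- rewrite (_ : _ \o _ = (fun z : borelC R => - complex.Im z)).
    exact: measurableT_comp.
  by apply/funext => -[].
Qed.

End BorelC.

(** * Finite sums of weighted point masses *)

Section AtomicMeasure.
Variables (R : realType) (n : nat) (w : nat -> {nonneg R}) (t : nat -> borelC R).

Definition atomic_measure : {measure set (borelC R) -> \bar R} :=
  msum (fun k => mscale (w k) \d_(t k)) n.

(** For nonnegative integrands the integral distributes over the sum of scaled Dirac measures.
    Applied to the absolute value this gives integrability, and the general formula follows by
    splitting [f] into positive and negative parts. *)
Lemma integral_atomic_measure (f : borelC R -> R) :
    measurable_fun setT f ->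
  atomic_measure.-integrable setT (fun z => (f z)%:E) /\
  \int[atomic_measure]_z f z = \sum_(k < n) (w k)%:num * f (t k).
Proof.
have ge0_int (g : borelC R -> R) :
    measurable_fun setT g -> (forall z, 0 <= g z) ->
    (\int[atomic_measure]_z (g z)%:E)%E =
    (\sum_(k < n) (w k)%:num * g (t k))%:E.
  move=> mg g_ge0; have mEg : measurable_fun setT (EFin \o g).
    exact/measurable_EFinP.
  have Eg_ge0 z : [set: borelC R] z -> (0 <= (g z)%:E)%E by rewrite lee_fin.
  rewrite ge0_integral_measure_sum // -sumEFin; apply: eq_bigr => k _.
  rewrite ge0_integral_mscale //.
  by rewrite integral_dirac // diracT mul1e.
move=> mf.
have int_g (g : borelC R -> R) : measurable_fun setT g ->
    atomic_measure.-integrable setT (EFin \o g).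
  move=> mg; apply/integrableP; split; first exact/measurable_EFinP.
  rewrite (eq_integral (fun z => (`|g z|)%:E)) //.
  by rewrite ge0_int ?ltry //; exact: measurableT_comp.
split; first exact: int_g.
pose p z := Num.max (f z) 0; pose q z := Num.max (- f z) 0.
have mp : measurable_fun setT p by exact: measurable_maxr.
have mq : measurable_fun setT q.
  by apply: measurable_maxr => //; exact: measurableT_comp.
have fE z : f z = p z - q z.
  rewrite /p /q; have [f_ge0|/ltW f_le0] := leP 0 (f z).
    by rewrite max_r ?oppr_le0 // subr0.
  by rewrite max_l ?oppr_ge0 // sub0r opprK.
rewrite (@eq_Rintegral _ _ _ _ _ (fun z => p z - q z)) //.
rewrite RintegralB //; try exact: int_g.
rewrite /Rintegral !ge0_int //=.
- by rewrite -sumrB; apply: eq_bigr => k _; rewrite fE mulrBr.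
- by move=> z; rewrite /q le_max lexx orbT.
- by move=> z; rewrite /p le_max lexx orbT.
Qed.

Lemma represents_atomic_measure (I : nat -> nat -> Prop)
    (g : nat -> nat -> R[i]) :
    (forall i j, I i j -> g i j = \sum_(k < n) (w k)%:num%:C *
       ((t k : R[i])^* ^+ i * (t k : R[i]) ^+ j)) ->
  represents atomic_measure I g.
Proof.
move=> gE i j Iij m; have [mRe mIm] := measurable_monomial R i j.
have [iRe eRe] := integral_atomic_measure mRe.
have [iIm eIm] := integral_atomic_measure mIm.
split; first by split.
rewrite /Cintegral eRe eIm gE //.
elim: n => [|N IH]; first by rewrite !big_ord0.
rewrite !big_ord_recr /= IH.
by case: (_ * t N ^+ j) => u v; simpc.
Qed.

End AtomicMeasure.

(** * The seven atoms *)

Section PolynomialFunctions.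
Variable R : realType.
Implicit Types (f : R[i] -> R[i]) (z : R[i]).

Definition monomial_fun (n : nat) (m : mono n) z : R[i] :=
  (z^*) ^+ (val m).1 * z ^+ (val m).2.

(** Polynomial functions in $z,\bar z$ of degree at most [n]. The coefficient vector is indexed like
    the moment matrix, so it can serve as a test vector for positivity. *)
Definition poly_fun (n : nat) f : Prop :=
  exists v : 'cV[R[i]]_#|mono n|,
    forall z, f z = \sum_c v c 0 * monomial_fun (enum_val c) z.

Lemma poly_fun_monomial (n i j : nat) : (i + j <= n)%N ->
  poly_fun n (fun z => (z^*) ^+ i * z ^+ j).
Proof.
move=> le_ij; exists (delta_mx (enum_rank (Mono le_ij)) 0) => z.
rewrite (bigD1 (enum_rank (Mono le_ij))) //= big1 => [|c ne_c]; last first.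
  by rewrite mxE (negbTE ne_c) mul0r.
rewrite mxE !eqxx mul1r addr0 enum_rankK /monomial_fun /= !inordK //; lia.
Qed.

Lemma poly_funD (n : nat) f1 f2 : poly_fun n f1 -> poly_fun n f2 ->
  poly_fun n (fun z => f1 z + f2 z).
Proof.
move=> [v1 E1] [v2 E2]; exists (v1 + v2) => z.
by rewrite E1 E2 -big_split; apply: eq_bigr => c _; rewrite mxE mulrDl.
Qed.

Lemma poly_funZ (n : nat) (c : R[i]) f : poly_fun n f ->
  poly_fun n (fun z => c * f z).
Proof.
move=> [v E]; exists (c *: v) => z.
by rewrite E mulr_sumr; apply: eq_bigr => k _; rewrite mxE mulrA.
Qed.

Lemma poly_fun_sum (n m : nat) (f : 'I_m -> R[i] -> R[i]) :
  (forall k, poly_fun n (f k)) -> poly_fun n (fun z => \sum_k f k z).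
Proof.
move=> /choice[v E]; exists (\sum_k v k) => z.
under eq_bigr => k _ do rewrite E.
rewrite exchange_big; apply: eq_bigr => c _.
by rewrite summxE mulr_suml.
Qed.

Lemma eq_poly_fun (n : nat) f1 f2 : f1 =1 f2 -> poly_fun n f1 -> poly_fun n f2.
Proof. by move=> E [v Ev]; exists v => z; rewrite -E. Qed.

Lemma poly_fun_monomialM (n i j : nat) f : (i + j <= 1)%N -> poly_fun n f ->
  poly_fun n.+1 (fun z => (z^*) ^+ i * z ^+ j * f z).
Proof.
move=> le_ij [v E].
apply: (@eq_poly_fun _ (fun z => \sum_c v c 0 *
  ((z^*) ^+ (i + (val (enum_val c)).1) * z ^+ (j + (val (enum_val c)).2)))).
  move=> z; rewrite E mulr_sumr; apply: eq_bigr => c _.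
  by rewrite /monomial_fun !exprD; ring.
apply: poly_fun_sum => c; apply/poly_funZ/poly_fun_monomial.
by have /= := valP (enum_val c); lia.
Qed.

(** With $\operatorname{Re}z=(z+\bar z)/2$ and $\operatorname{Im}z=(z-\bar z)/(2i)$, the
    coefficients of $z$ and $\bar z$ are $(c_1\mp ic_2)/2$. The cubics used below are sums of
    products of such affine factors. *)
Lemma poly_fun_affineM (n : nat) (c0 c1 c2 : R) f : poly_fun n f ->
  poly_fun n.+1 (fun z =>
    (c0 + c1 * complex.Re z + c2 * complex.Im z)%:C * f z).
Proof.
move=> fP; have M i j ij := @poly_fun_monomialM n i j f ij fP.
have := poly_funD (poly_funZ c0%:C (M 0 0 isT)%N)
  (poly_funD (poly_funZ (c1 / 2 -i* (c2 / 2)) (M 0 1 isT)%N)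
             (poly_funZ (c1 / 2 +i* (c2 / 2)) (M 1 0 isT)%N)).
apply: eq_poly_fun => z; rewrite !expr0 !expr1 !(mul1r, mulr1) !mulrA -!mulrDl.
congr (_ * _); case: z => x y; simpc; congr (_ +i* _) => /=; by field.
Qed.

(** If $v$ is the coefficient vector of $f$, then $v^*Mv=\sum_k w_k|f(t_k)|^2$, and only the term of
    [k0] survives. *)
Lemma psd_atom_weight_ge0 (n m : nat) (omega : nat -> nat -> R[i])
    (w : 'I_m -> R) (t : 'I_m -> R[i]) f (k0 : 'I_m) :
    psdmx (moment_mx n omega) ->
    (forall i j, (i + j <= n + n)%N ->
       omega i j = \sum_k (w k)%:C * ((t k)^* ^+ i * t k ^+ j)) ->
    poly_fun n f -> f (t k0) != 0 -> (forall k, k != k0 -> f (t k) = 0) ->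
  0 <= w k0.
Proof.
move=> [_ Mpsd] omegaE [v fE] fk0_neq0 f0.
suff E : ((map_mx Num.conj v)^T *m moment_mx n omega *m v) 0 0 =
    \sum_k (w k)%:C * ((f (t k))^* * f (t k)).
  have := Mpsd v; rewrite E (bigD1 k0) //= big1 => [|k /f0 ->]; last first.
    by rewrite !mulr0.
  rewrite addr0 [_^* * _]mulrC pmulr_lge0 ?lecR //.
  by rewrite lt_def mulcJ_ge0 mulf_neq0 // conjc_eq0.
rewrite mxE; under eq_bigr => c _ do rewrite mxE mulr_suml.
transitivity (\sum_c \sum_r \sum_k (w k)%:C *
    ((v r 0 * monomial_fun (enum_val r) (t k))^* *
     (v c 0 * monomial_fun (enum_val c) (t k)))).
  apply: eq_bigr => c _; apply: eq_bigr => r _.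
  rewrite !mxE; case: (enum_val r) (enum_val c) => [[k l] kl] [[i j] ij] /=.
  (* Conjugating the row monomial swaps its exponents, which matches the index $(i+l,j+k)$ of the
     entry. *)
  rewrite omegaE; last by move: kl ij => /=; lia.
  rewrite mulr_sumr mulr_suml; apply: eq_bigr => s _.
  rewrite /monomial_fun /= !rmorphM /= !rmorphXn /=.
  rewrite [X in X ^+ k * _](_ : _ = t s); last exact: conjcK.
  rewrite !exprD.
  ring.
under eq_bigr => c _ do rewrite exchange_big.
rewrite exchange_big; apply: eq_bigr => k _; rewrite fE rmorph_sum /=.
rewrite mulr_suml mulr_sumr exchange_big; apply: eq_bigr => r _ /=.
by rewrite mulr_sumr mulr_sumr.
Qed.

End PolynomialFunctions.

(** * Atoms, interpolation weights and their positivity *)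

Section Atoms.
Variables (R : realType) (x y r : R).
Hypotheses (x_gt0 : 0 < x) (y_gt0 : 0 < y) (r_gt0 : 0 < r).
Hypothesis r2E : r ^+ 2 = x ^+ 2 - 3 * y ^+ 2.
(* The coefficients of [P] in terms of the coordinates of its zeros. *)
Let a := 2 * (y ^+ 2 - x ^+ 2).
Let b := x ^+ 2 + y ^+ 2.

Definition atom_re (k : nat) : R := nth 0 [:: 0; r; - r; x; x; - x; - x] k.

Definition atom_im (k : nat) : R := nth 0 [:: 0; 0; 0; y; - y; y; - y] k.

Definition atom (k : nat) : R[i] := atom_re k +i* atom_im k.

Lemma atom_rec (k : nat) :
  atom k ^+ 3 = - a%:C * atom k - b%:C * (atom k)^*.
Proof.
(* Beyond the list both coordinates default to 0, and 0 is a zero of [P]. *)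
have [k_ge7|] := leqP 7 k.
  rewrite /atom /atom_re /atom_im !nth_default //.
  apply/eqP; rewrite !exprS expr0 eq_complex /=.
  by apply/andP; split; apply/eqP; ring.
case: k => [|[|[|[|[|[|[|k]]]]]]] // _.
all: rewrite /atom /a /b !exprS expr0 mulr1 /atom_re /atom_im.
all: apply/eqP; rewrite eq_complex /=; apply/andP; split; apply/eqP.
all: by ring: r2E.
Qed.

Section Weights.
Variable g : nat -> nat -> R[i].

Let c := complex.Re (g 0%N 0%N).
Let p := complex.Re (g 0%N 1%N).
Let q := complex.Im (g 0%N 1%N).
Let u := complex.Re (g 0%N 2%N).
Let v := complex.Im (g 0%N 2%N).
Let d := complex.Re (g 1%N 1%N).
Let e := complex.Re (g 1%N 2%N).

(* The weights are the values of the functional [g] at the cubic Lagrange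
   interpolants of the atoms: with [z = X + i Y] the moments of [X], [Y], [XY],
   [X^2], [Y^2] and [X Y^2] are [p], [q], [v / 2], [(u + d) / 2], [(d - u) / 2]
   and [(e - r^2 p) / 4]. *)
Definition real_weight (s : R) :=
  (((u + d) / 2 - x ^+ 2 * (d - u) / (2 * y ^+ 2)) / r ^+ 2
   + s * (p - (e - r ^+ 2 * p) / (4 * y ^+ 2)) / r) / 2.

(** The signs select the atom $sx+is'y$ on the circle $|z|^2=b$. With $z=X+iY$, this is the value of
    [g] at $Y(Y+s'y)(X+sx)/(4sxy^2)$. *)
Definition circle_weight (s s' : R) :=
  (s * (e - r ^+ 2 * p) / (4 * x) + s * s' * y * v / (2 * x)
   + (d - u) / 2 + s' * y * q) / (4 * y ^+ 2).

Definition weight (k : nat) : R :=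
  nth 0 [:: c - ((u + d) / 2 - x ^+ 2 * (d - u) / (2 * y ^+ 2)) / r ^+ 2
                - (d - u) / (2 * y ^+ 2);
            real_weight 1; real_weight (-1);
            circle_weight 1 1; circle_weight 1 (-1);
            circle_weight (-1) 1; circle_weight (-1) (-1)] k.

Definition atomic_moment (i j : nat) : R[i] :=
  \sum_(k < 7) (weight k)%:C * ((atom k)^* ^+ i * atom k ^+ j).

Lemma atomic_moment_conj i j : (atomic_moment i j)^* = atomic_moment j i.
Proof.
rewrite /atomic_moment rmorph_sum; apply: eq_bigr => k _.
case: (atom k) => s s'; rewrite !rmorphM !rmorphXn /= oppr0 opprK.
by rewrite [X in _ * X]mulrC.
Qed.

Lemma atomic_moment_rec i j : atomic_moment i j.+3 =
  - a%:C * atomic_moment i j.+1 - b%:C * atomic_moment i.+1 j.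
Proof.
rewrite /atomic_moment !mulr_sumr -sumrB; apply: eq_bigr => k _.
have -> : atom k ^+ j.+3 = atom k ^+ j * atom k ^+ 3 by rewrite -exprD addn3.
by rewrite atom_rec !exprS; ring.
Qed.

(** Separating real and imaginary parts turns the interpolation identities into rational identities
    over [R]. *)
Lemma atomic_momentE (i j : nat) (fR fI : R -> R -> R) :
    (forall s s' : R, (s -i* s') ^+ i * (s +i* s') ^+ j = fR s s' +i* fI s s') ->
  atomic_moment i j =
    (\sum_(k < 7) weight k * fR (atom_re k) (atom_im k)) +i*
    (\sum_(k < 7) weight k * fI (atom_re k) (atom_im k)).
Proof.
move=> fE; rewrite /atomic_moment; elim: 7%N => [|n IH]; first by rewrite !big_ord0.
by rewrite !big_ord_recr /= IH fE; simpc.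
Qed.

Hypothesis g_conj : forall i j : nat, (i + j <= 6)%N -> (g i j)^* = g j i.
Hypothesis g12 : complex.Im (g 1%N 2%N) = b * complex.Im (g 0%N 1%N).
Hypothesis g22 : g 2%N 2%N = - (2 * b * complex.Re (g 2%N 0%N))%:C
                             - (a - b)%:C * g 1%N 1%N.

Local Ltac expand_moment :=
  rewrite !big_ord_recl big_ord0 /= /weight /real_weight /circle_weight
    /atom_re /atom_im /=.

(** By symmetry the initial moments amount to nine real numbers. The weights use the seven numbers
    [c], [p], [q], [u], [v], [d], [e]; the other two, $\operatorname{Im}g_{12}$ and $g_{22}$, are
    fixed by [g12] and [g22]. *)
Lemma atomic_moment_init i j : (i <= j < 3)%N -> atomic_moment i j = g i j.
Proof.
have x0 : x != 0 by rewrite gt_eqF.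
have y0 : y != 0 by rewrite gt_eqF.
have r0 : r != 0 by rewrite gt_eqF.
have g00 : g 0%N 0%N = c%:C.
  have := g_conj (isT : 0 + 0 <= 6)%N; rewrite /c.
  by case: (g 0%N 0%N) => m n [] /= ?; congr (_ +i* _); lra.
have g11 : g 1%N 1%N = d%:C.
  have := g_conj (isT : 1 + 1 <= 6)%N; rewrite /d.
  by case: (g 1%N 1%N) => m n [] /= ?; congr (_ +i* _); lra.
have g01 : g 0%N 1%N = p +i* q by rewrite /p /q; case: (g 0%N 1%N).
have g02 : g 0%N 2%N = u +i* v by rewrite /u /v; case: (g 0%N 2%N).
have g12' : g 1%N 2%N = e +i* (b * q).
  by rewrite /e /q; move: g12; case: (g 1%N 2%N) => m n /= ->.
have g22' : g 2%N 2%N = (- (2 * b * u) - (a - b) * d)%:C.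
  rewrite g22 g11 /u -(g_conj (isT : 0 + 2 <= 6)%N).
  case: (g 0%N 2%N) => m n; apply/eqP; rewrite eq_complex /=.
  by apply/andP; split; apply/eqP; ring.
move=> ij3.
have : (i, j) \in [:: (0, 0); (0, 1); (0, 2); (1, 1); (1, 2); (2, 2)]%N.
  by case/andP: ij3; case: i j => [|[|[|i]]] [|[|[|j]]].
clear g_conj g12 g22.
rewrite !inE => /or4P[||| /or3P[||]] /eqP[-> ->].
- rewrite g00 (@atomic_momentE _ _ (fun _ _ => 1) (fun _ _ => 0)); last first.
    by move=> s s'; rewrite mul1r.
  apply/eqP; rewrite eq_complex; apply/andP; split; apply/eqP => /=.
  + expand_moment.
    by field; rewrite x0 y0 r0.
  + by rewrite big1 // => k _; rewrite mulr0.
- rewrite g01 (@atomic_momentE _ _ (fun s _ => s) (fun _ s => s)); last first.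
    by move=> s s'; rewrite mul1r.
  congr (_ +i* _).
  + expand_moment.
    by field; rewrite x0 y0 r0.
  + expand_moment.
    by field; rewrite x0 y0.
- rewrite g02 (@atomic_momentE 0 2 (fun s s' => s * s - s' * s')
    (fun s s' => 2 * s * s')); last first.
    move=> s s'; apply/eqP.
    rewrite ?expr0 ?expr1 ?expr2 ?mul1r ?mulr1 eq_complex /=.
    by apply/andP; split; apply/eqP; ring.
  apply/eqP; rewrite eq_complex; apply/andP; split; apply/eqP => /=.
  + expand_moment.
    by field; rewrite x0 y0 ?r0.
  + expand_moment.
    by field; rewrite x0 y0 ?r0.
- rewrite g11 (@atomic_momentE 1 1 (fun s s' => s * s + s' * s')
    (fun s s' => 0)); last first.
    move=> s s'; apply/eqP.
    rewrite ?expr0 ?expr1 ?expr2 ?mul1r ?mulr1 eq_complex /=.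
    by apply/andP; split; apply/eqP; ring.
  apply/eqP; rewrite eq_complex; apply/andP; split; apply/eqP => /=.
  + expand_moment.
    by field; rewrite x0 y0 ?r0.
  + by rewrite big1 // => k _; rewrite mulr0.
- rewrite g12' (@atomic_momentE 1 2 (fun s s' => (s * s + s' * s') * s)
    (fun s s' => (s * s + s' * s') * s')); last first.
    move=> s s'; apply/eqP.
    rewrite ?expr0 ?expr1 ?expr2 ?mul1r ?mulr1 eq_complex /=.
    by apply/andP; split; apply/eqP; ring.
  apply/eqP; rewrite eq_complex; apply/andP; split; apply/eqP => /=.
  + expand_moment.
    rewrite /b; by field: r2E; rewrite x0 y0 ?r0.
  + expand_moment.
    rewrite /b; by field: r2E; rewrite x0 y0 ?r0.
- rewrite g22' (@atomic_momentE 2 2 (fun s s' => (s * s + s' * s') ^+ 2)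
    (fun s s' => 0)); last first.
    move=> s s'; apply/eqP.
    rewrite ?expr0 ?expr1 ?expr2 ?mul1r ?mulr1 eq_complex /=.
    by apply/andP; split; apply/eqP; ring.
  apply/eqP; rewrite eq_complex; apply/andP; split; apply/eqP => /=.
  + expand_moment.
    rewrite /a /b; by field: r2E; rewrite x0 y0 ?r0.
  + by rewrite big1 // => k _; rewrite mulr0.
Qed.

Hypothesis g_rec : forall i j : nat, (i + j.+3 <= 6)%N ->
  g i j.+3 = - a%:C * g i j.+1 - b%:C * g i.+1 j.

Lemma atomic_moment_eq i j : (i + j <= 6)%N -> atomic_moment i j = g i j.
Proof.
apply: (@rec_agree _ a b 6) => //.
- by move=> k l _; exact: atomic_moment_conj.
- by move=> k l _; exact: atomic_moment_rec.
- exact: atomic_moment_init.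
Qed.

Lemma weight_ge0_witness (phi : R -> R -> R) (k : nat) : (k < 7)%N ->
    psdmx (moment_mx 3 g) ->
    poly_fun 3 (fun z : R[i] => (phi (complex.Re z) (complex.Im z))%:C) ->
    phi (atom_re k) (atom_im k) != 0 ->
    (forall l, (l < 7)%N -> l != k -> phi (atom_re l) (atom_im l) = 0) ->
  0 <= weight k.
Proof.
move=> lt_k7 g_psd phiP phi_k phi0.
apply: (@psd_atom_weight_ge0 R 3 7 g (weight \o val) (atom \o val) _
  (Ordinal lt_k7) g_psd _ phiP) => /=.
- by move=> i j ij; rewrite -atomic_moment_eq.
- by rewrite eq_complex /= eqxx andbT.
- by move=> l ne_lk; rewrite phi0.
Qed.

(** The hyperbola $s^2-3t^2=r^2$ passes through the six nonzero atoms. *)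
Definition origin_witness (s t : R) := r ^+ 2 - s ^+ 2 + 3 * t ^+ 2.

(** Both $y^2s^2-x^2t^2$ and $s(y^2-t^2)$ vanish at the origin and at the four nonreal atoms; the
    factor [e1 * r] makes the sum vanish at $-e_1r$ as well, leaving $e_1r$. *)
Definition real_witness (e1 s t : R) :=
  (y * s) ^+ 2 - (x * t) ^+ 2 + e1 * r * s * (y ^+ 2 - t ^+ 2).

(** Three lines cover all atoms but $e_1x+ie_2y$: the real axis, the horizontal line through the
    opposite height, and the vertical line through the opposite abscissa. *)
Definition circle_witness (e1 e2 s t : R) :=
  t * (t + e2 * y) * (s + e1 * x).

Lemma poly_fun_origin : poly_fun 3 (fun z : R[i] =>
  (origin_witness (complex.Re z) (complex.Im z))%:C).
Proof.
(* The constant 1 is given degree bound one, so that two affine factors reach the bound three. *)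
have c1 := poly_fun_monomial R (isT : (0 + 0 <= 1)%N).
have := poly_funD
  (poly_fun_affineM r (-1) 0 (poly_fun_affineM r 1 0 c1))
  (poly_fun_affineM 0 0 3 (poly_fun_affineM 0 0 1 c1)).
apply: eq_poly_fun => z; rewrite !expr0 !mulr1 -!rmorphM -rmorphD.
congr (_%:C); rewrite /origin_witness /real_witness /circle_witness.
by ring.
Qed.

Lemma poly_fun_real (s : R) : poly_fun 3 (fun z : R[i] =>
  (real_witness s (complex.Re z) (complex.Im z))%:C).
Proof.
have c1 := poly_fun_monomial R (isT : (0 + 0 <= 1)%N).
have c0 := poly_fun_monomial R (isT : (0 + 0 <= 0)%N).
have := poly_funD
  (poly_fun_affineM 0 y (- x) (poly_fun_affineM 0 y x c1))
  (poly_fun_affineM 0 (s * r) 0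
    (poly_fun_affineM y 0 (-1) (poly_fun_affineM y 0 1 c0))).
apply: eq_poly_fun => z; rewrite !expr0 !mulr1 -!rmorphM -rmorphD.
congr (_%:C); rewrite /origin_witness /real_witness /circle_witness.
by ring.
Qed.

Lemma poly_fun_circle (s s' : R) : poly_fun 3 (fun z : R[i] =>
  (circle_witness s s' (complex.Re z) (complex.Im z))%:C).
Proof.
have c0 := poly_fun_monomial R (isT : (0 + 0 <= 0)%N).
have := poly_fun_affineM 0 0 1
  (poly_fun_affineM (s' * y) 0 1 (poly_fun_affineM (s * x) 1 0 c0)).
apply: eq_poly_fun => z; rewrite !expr0 !mulr1 -!rmorphM.
congr (_%:C); rewrite /origin_witness /real_witness /circle_witness.
by ring.
Qed.

Local Ltac expand_witness :=
  rewrite /origin_witness /real_witness /circle_witness /atom_re /atom_im /=.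

Lemma weight_ge0 (k : nat) : psdmx (moment_mx 3 g) -> 0 <= weight k.
Proof.
(* The atomic measure takes a nonnegative weight at every natural index, so the default value 0 has
   to be covered too. *)
move=> g_psd; have [k_ge7|] := leqP 7 k; first by rewrite /weight nth_default.
have wit := weight_ge0_witness.
have r2_gt0 : 0 < r ^+ 2 by rewrite exprn_gt0.
have y2_gt0 : 0 < y ^+ 2 by rewrite exprn_gt0.
have xy_gt0 : 0 < x * y ^+ 2 by rewrite mulr_gt0.
have ry_gt0 : 0 < r ^+ 2 * y ^+ 2 by rewrite mulr_gt0.
case: k => [|[|[|[|[|[|[|k]]]]]]] // lt_k7.
- apply: (wit origin_witness _ lt_k7 g_psd poly_fun_origin).
    expand_witness.
    (* In each case the witness is evaluated at its own atom: $r^2$ at the origin, $2r^2y^2$ at $\pm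
       r$, and $\pm4xy^2$ at the nonreal atoms. *)
    rewrite [X in X != 0](_ : _ = r ^+ 2); last by ring.
    by rewrite ?oppr_eq0 gt_eqF // ?mulr_gt0.
  by case=> [|[|[|[|[|[|[|l]]]]]]] // _ _; expand_witness; ring: r2E.
- apply: (wit (real_witness 1) _ lt_k7 g_psd (poly_fun_real 1)).
    expand_witness.
    rewrite [X in X != 0](_ : _ = 2 * (r ^+ 2 * y ^+ 2)); last by ring.
    by rewrite ?oppr_eq0 gt_eqF // ?mulr_gt0.
  by case=> [|[|[|[|[|[|[|l]]]]]]] // _ _; expand_witness; ring: r2E.
- apply: (wit (real_witness (-1)) _ lt_k7 g_psd (poly_fun_real (-1))).
    expand_witness.
    rewrite [X in X != 0](_ : _ = 2 * (r ^+ 2 * y ^+ 2)); last by ring.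
    by rewrite ?oppr_eq0 gt_eqF // ?mulr_gt0.
  by case=> [|[|[|[|[|[|[|l]]]]]]] // _ _; expand_witness; ring: r2E.
- apply: (wit (circle_witness 1 1) _ lt_k7 g_psd (poly_fun_circle 1 1)).
    expand_witness.
    rewrite [X in X != 0](_ : _ = 4 * (x * y ^+ 2)); last by ring.
    by rewrite ?oppr_eq0 gt_eqF // ?mulr_gt0.
  by case=> [|[|[|[|[|[|[|l]]]]]]] // _ _; expand_witness; ring: r2E.
- apply: (wit (circle_witness 1 (-1)) _ lt_k7 g_psd (poly_fun_circle 1 (-1))).
    expand_witness.
    rewrite [X in X != 0](_ : _ = 4 * (x * y ^+ 2)); last by ring.
    by rewrite ?oppr_eq0 gt_eqF // ?mulr_gt0.
  by case=> [|[|[|[|[|[|[|l]]]]]]] // _ _; expand_witness; ring: r2E.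
- apply: (wit (circle_witness (-1) 1) _ lt_k7 g_psd (poly_fun_circle (-1) 1)).
    expand_witness.
    rewrite [X in X != 0](_ : _ = - (4 * (x * y ^+ 2))); last by ring.
    by rewrite ?oppr_eq0 gt_eqF // ?mulr_gt0.
  by case=> [|[|[|[|[|[|[|l]]]]]]] // _ _; expand_witness; ring: r2E.
- apply: (wit (circle_witness (-1) (-1)) _ lt_k7 g_psd (poly_fun_circle (-1) (-1))).
    expand_witness.
    rewrite [X in X != 0](_ : _ = - (4 * (x * y ^+ 2))); last by ring.
    by rewrite ?oppr_eq0 gt_eqF // ?mulr_gt0.
  by case=> [|[|[|[|[|[|[|l]]]]]]] // _ _; expand_witness; ring: r2E.
Qed.

End Weights.
End Atoms.

(** * The zeros of [P] and measures living on them *)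

Section ZeroSet.
Variables (R : realType) (a b : R).

(** For $z=s+it$ one has $h=2it(s^2+t^2-b)$. If $t\ne0$, then $3s^2-t^2=b-a>0$ forces $s\ne0$, so
    also $s^2-3t^2=-a-b$; half the difference of the two is $s^2+t^2=b$. *)
Lemma zero_set_h (z : R[i]) : b < - a -> - a < 2 * b ->
    z ^+ 3 = - a%:C * z - b%:C * z^* ->
  z^* * z ^+ 2 - z^* ^+ 2 * z - b%:C * z + b%:C * z^* = 0.
Proof.
move=> ltb lta; case: z => s t /eqP.
rewrite !exprS !expr0 !mulr1 eq_complex /= => /andP[/eqP Es /eqP Et].
have {Es Et} [Es Et] : s * (s ^+ 2 - 3 * t ^+ 2) = s * (- a - b) /\
    t * (3 * s ^+ 2 - t ^+ 2) = t * (b - a).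
  by split; rewrite !expr2; lra.
have t0 : t * (s ^+ 2 + t ^+ 2 - b) = 0.
  have [->|t_neq0] := eqVneq t 0; first by rewrite mul0r.
  have {Et} E1 : 3 * s ^+ 2 - t ^+ 2 = b - a by exact: (mulfI t_neq0).
  have s_neq0 : s != 0.
    apply/eqP => s0; have := sqr_ge0 t; move: E1.
    rewrite s0 expr2 mul0r mulr0 sub0r {Es s0 t_neq0}; lra.
  have {Es} E2 : s ^+ 2 - 3 * t ^+ 2 = - a - b by exact: (mulfI s_neq0).
  by rewrite [X in t * X](_ : _ = 0) ?mulr0 // {s_neq0 t_neq0}; lra.
apply/eqP; rewrite eq_complex /=; apply/andP; split; apply/eqP; first by ring.
transitivity (2 * (t * (s ^+ 2 + t ^+ 2 - b))); last by rewrite t0 mulr0.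
ring.
Qed.

(** The two inequalities are the positivity of $r^2=-(a+b)$ and of $4y^2=2b+a$; together they give
    that of $4x^2=2b-a$. *)
Lemma zero_set_param : b < - a -> - a < 2 * b -> exists x y r : R,
  [/\ 0 < x, 0 < y, 0 < r, r ^+ 2 = x ^+ 2 - 3 * y ^+ 2 &
      a = 2 * (y ^+ 2 - x ^+ 2) /\ b = x ^+ 2 + y ^+ 2].
Proof.
move=> ltb lta; have x2_gt0 : 0 < (2 * b - a) / 4 by lra.
have y2_gt0 : 0 < (2 * b + a) / 4 by lra.
have r2_gt0 : 0 < - (a + b) by lra.
exists (Num.sqrt ((2 * b - a) / 4)), (Num.sqrt ((2 * b + a) / 4)),
  (Num.sqrt (- (a + b))).
by split; rewrite ?sqrtr_gt0 // !sqr_sqrtr ?ltW //; [|split]; lra.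
Qed.

End ZeroSet.

Section RepresentedMoments.
Variables (R : realType) (mu : {measure set (borelC R) -> \bar R}).

(** Integrability is bundled with the value so that linear combinations of moments can be assembled
    term by term. *)
Definition has_integral (f : borelC R -> R[i]) (v : R[i]) : Prop :=
  Cintegrable mu f /\ Cintegral mu f = v.

Lemma has_integralD f q v w : has_integral f v -> has_integral q w ->
  has_integral (fun z => f z + q z) (v + w).
Proof.
by move=> [fi <-] [qi <-]; split; [exact: CintegrableD | exact: CintegralD].
Qed.

Lemma has_integralZ c f v : has_integral f v ->
  has_integral (fun z => c * f z) (c * v).
Proof.
by move=> [fi <-]; split; [exact: CintegrableZ | exact: CintegralZ].
Qed.

Variables (omega : nat -> nat -> R[i]) (a b : R).
Hypothesis omega_rec : forall i j : nat, (i + j <= 3)%N ->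
  omega i j.+3 = - a%:C * omega i j.+1 - b%:C * omega i.+1 j.
Hypothesis mu_omega : represents mu (fun i j => (i + j <= 6)%N) omega.

Lemma has_moment (i j : nat) : (i + j <= 6)%N ->
  has_integral (fun z : R[i] => (z^*) ^+ i * z ^+ j) (omega i j).
Proof. by move=> /mu_omega[? ->]. Qed.

(** The integral of $|P|^2$ is a combination of moments of degree at most six that the recurrence
    annihilates; [q] vanishes wherever $|P|^2$ does. *)
Lemma Cintegral_zero_set q v : has_integral q v ->
  (forall z : R[i], z ^+ 3 = - a%:C * z - b%:C * z^* -> q z = 0) -> v = 0.
Proof.
move=> [qi <-] q0.
have M i j ij := @has_moment i j ij.
have [fi fE] := has_integralD (M 3 3 isT)%N
  (has_integralD (has_integralZ a%:C (M 1 3 isT)%N)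
  (has_integralD (has_integralZ b%:C (M 0 4 isT)%N)
  (has_integralD (has_integralZ a%:C (M 3 1 isT)%N)
  (has_integralD (has_integralZ (a%:C * a%:C) (M 1 1 isT)%N)
  (has_integralD (has_integralZ (a%:C * b%:C) (M 0 2 isT)%N)
  (has_integralD (has_integralZ b%:C (M 4 0 isT)%N)
  (has_integralD (has_integralZ (a%:C * b%:C) (M 2 0 isT)%N)
                 (has_integralZ (b%:C * b%:C) (M 1 1 isT)%N)))))))).
move: fi fE; set f := fun z => _ => fi fE.
(* In nested position [z^*] is [Num.conj z], convertible to [conjc z] but not
   syntactically equal to it. *)
pose w (z : R[i]) : R[i] := z ^+ 3 + a%:C * z + b%:C * z^*.
have fE' (z : R[i]) : f z = w z * conjc (w z).
  have -> : conjc (w z) = (z^*) ^+ 3 + a%:C * z^* + b%:C * z.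
    have conjM c x : conjc (c%:C * x) = c%:C * conjc x :> R[i].
      by rewrite rmorphM /= oppr0.
    have conjX x : conjc (x ^+ 3) = conjc x ^+ 3 :> R[i] by rewrite rmorphXn.
    have conjD x y : conjc (x + y) = conjc x + conjc y :> R[i].
      by rewrite rmorphD.
    rewrite /w !conjD conjX !conjM; congr (_ + _ * _).
    exact: conjcK.
  by rewrite /f /w; ring.
apply: (Cintegral_vanish fi _ _ qi).
(* The nine terms group into $\bar z^3P$, $a\bar zP$ and $bzP$, each of which integrates to zero. *)
- rewrite fE (@omega_rec 3 0 isT) (@omega_rec 1 0 isT) (@omega_rec 0 1 isT).
  by ring.
- by move=> z; rewrite fE' mulcJ_ge0.
- move=> z; rewrite fE' => /eqP; rewrite mulf_eq0 conjc_eq0 orbb => /eqP w0.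
  by apply: q0; apply/eqP; rewrite -subr_eq0 -w0 /w; apply/eqP; ring.
Qed.

End RepresentedMoments.

Lemma moment_sequence_represented (R : realType) (a b : R)
    (g : nat -> nat -> R[i]) :
    b < - a -> - a < 2 * b ->
    (forall i j : nat, (g i j)^* = g j i) ->
    (forall i j : nat, g i j.+3 = - a%:C * g i j.+1 - b%:C * g i.+1 j) ->
    complex.Im (g 1%N 2%N) = b * complex.Im (g 0%N 1%N) ->
    g 2%N 2%N + (2 * b * complex.Re (g 2%N 0%N))%:C
      + (a - b)%:C * g 1%N 1%N = 0 ->
    psdmx (moment_mx 3 g) ->
  exists mu : {measure set (borelC R) -> \bar R},
    represents mu (fun _ _ => True) g.
Proof.
move=> ltb lta g_conj g_rec g12 g22 g_psd.
have [x [y [r [x_gt0 y_gt0 r_gt0 r2E [aE bE]]]]] := zero_set_param ltb lta.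
subst a b.
have g22' : g 2%N 2%N = - (2 * (x ^+ 2 + y ^+ 2) * complex.Re (g 2%N 0%N))%:C
    - (2 * (y ^+ 2 - x ^+ 2) - (x ^+ 2 + y ^+ 2))%:C * g 1%N 1%N.
  by apply/eqP; rewrite -subr_eq0 -g22; apply/eqP; ring.
have w_ge0 k : 0 <= weight x y r g k by exact: weight_ge0.
exists (atomic_measure 7 (fun k => NngNum (w_ge0 k)) (atom x y r)).
apply: represents_atomic_measure => i j _ /=.
rewrite -/(atomic_moment x y r g i j).
(* The bound is chosen separately for each moment, so the one measure represents moments of every
   degree. *)
apply: (@rec_agree _ (2 * (y ^+ 2 - x ^+ 2)) (x ^+ 2 + y ^+ 2) (i + j)) => //.
- by move=> k l _; exact: atomic_moment_conj.
- by move=> k l _; exact: atomic_moment_rec.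
- by move=> k l kl; rewrite atomic_moment_init.
Qed.

(** * Equivalence of the six conditions *)

Theorem theorem17 (R : realType) (omega : nat -> nat -> R[i]) (a b : R)
    (omega_conj : forall i j : nat, (i + j <= 6)%N ->
       (omega i j)^* = omega j i)
    (omega00_gt0 : 0 < omega 0%N 0%N)
    (M_psd : psdmx (moment_mx 3 omega))
    (Z3E : moment_col omega (isT : (0 + 3 <= 3)%N) =
           - (a%:C *: moment_col omega (isT : (0 + 1 <= 3)%N))
           - b%:C *: moment_col omega (isT : (1 + 0 <= 3)%N))
    (ltb : b < - a) (lta : - a < 2 * b)
    (h P : {poly {poly R[i]}})
    (hE : h = pzbar * pz ^+ 2 - pzbar ^+ 2 * pz
              - pconst b%:C * pz + pconst b%:C * pzbar)
    (PE : P = pz ^+ 3 + pconst a%:C * pz + pconst b%:C * pzbar)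
    (gamma : nat -> nat -> R[i])
    (gamma_RDIS : is_RDIS 3 omega P gamma) :
  [<-> (exists mu : {measure set (borelC R) -> \bar R},
          represents mu (fun i j => (i + j <= 6)%N) omega);
       (exists mu : {measure set (borelC R) -> \bar R},
          represents mu (fun _ _ => True) gamma);
       (Lambda omega h = 0 /\ Lambda omega (pz * h) = 0);
       (complex.Im (omega 1%N 2%N) = b * complex.Im (omega 0%N 1%N) /\
        omega 2%N 2%N + (2 * b * complex.Re (omega 2%N 0%N))%:C
          + (a - b)%:C * omega 1%N 1%N = 0);
       h \in charpolys gamma;
       moment_col omega (isT : (1 + 2 <= 3)%N)
         - moment_col omega (isT : (2 + 1 <= 3)%N)
         - b%:C *: moment_col omega (isT : (0 + 1 <= 3)%N)
         + b%:C *: moment_col omega (isT : (1 + 0 <= 3)%N) = 0].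
Proof.
(* This is the column relation read in row $\bar z^jz^i$. *)
have omega_rec i j : (i + j <= 3)%N ->
    omega i j.+3 = - a%:C * omega i j.+1 - b%:C * omega i.+1 j.
  rewrite addnC => le_ji.
  have col_eq (u v w : 'cV[R[i]]_#|mono 3|) k : u = - (a%:C *: v) - b%:C *: w ->
      u k 0 = - a%:C * v k 0 - b%:C * w k 0.
    by move=> ->; rewrite !mxE mulNr.
  have := col_eq _ _ _ (enum_rank (Mono le_ji)) Z3E.
  by rewrite !moment_colE.
have gamma_rec := RDIS_rec PE gamma_RDIS.
have gamma_conj i j : (gamma i j)^* = gamma j i by case: gamma_RDIS => ? [].
(* Thus [gamma] extends all of [omega], not only its initial values. *)
have gamma_omega i j : (i + j <= 6)%N -> gamma i j = omega i j.
  apply: (@rec_agree _ a b 6) => // k l kl.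
  - by apply: omega_rec; move: kl; rewrite !addnS !ltnS.
  - by case: gamma_RDIS => c [_ gamma_init _ _]; exact: gamma_init.
have LhE : Lambda omega h =
    omega 1%N 2%N - omega 2%N 1%N - b%:C * omega 0%N 1%N + b%:C * omega 1%N 0%N.
  exact: Lambda_hE.
have LzhE : Lambda omega (pz * h) =
    omega 1%N 3%N - omega 2%N 2%N - b%:C * omega 0%N 2%N + b%:C * omega 1%N 1%N.
  exact: Lambda_zhE.
have i_iii : (exists mu : {measure set (borelC R) -> \bar R},
    represents mu (fun i j => (i + j <= 6)%N) omega) ->
    Lambda omega h = 0 /\ Lambda omega (pz * h) = 0.
  move=> [mu mu_omega].
  have M i j ij := @has_moment R mu omega mu_omega i j ij.
  split.
    have mh := has_integralD (has_integralD (has_integralD (M 1 2 isT)%N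
      (has_integralZ (-1) (M 2 1 isT)%N)) (has_integralZ (- b%:C) (M 0 1 isT)%N))
      (has_integralZ b%:C (M 1 0 isT)%N).
    rewrite LhE -(Cintegral_zero_set omega_rec mu_omega mh); first by ring.
    by move=> z /(zero_set_h ltb lta) <-; ring.
  have mzh := has_integralD (has_integralD (has_integralD (M 1 3 isT)%N
    (has_integralZ (-1) (M 2 2 isT)%N)) (has_integralZ (- b%:C) (M 0 2 isT)%N))
    (has_integralZ b%:C (M 1 1 isT)%N).
  rewrite LzhE -(Cintegral_zero_set omega_rec mu_omega mzh); first by ring.
  by move=> z /(zero_set_h ltb lta) hz0; rewrite -[RHS](mulr0 z) -hz0; ring.
have iii_iv : (Lambda omega h = 0 /\ Lambda omega (pz * h) = 0) <->
    (complex.Im (omega 1%N 2%N) = b * complex.Im (omega 0%N 1%N) /\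
        omega 2%N 2%N + (2 * b * complex.Re (omega 2%N 0%N))%:C
          + (a - b)%:C * omega 1%N 1%N = 0).
  (* As $\bar h=-h$, the value at [h] is purely imaginary and gives one real equation. *)
  have LhE' : Lambda omega h = (2 *
      (complex.Im (omega 1%N 2%N) - b * complex.Im (omega 0%N 1%N))) *i.
    rewrite LhE -(omega_conj 1%N 2%N isT) -(omega_conj 0%N 1%N isT).
    case: (omega 1%N 2%N) (omega 0%N 1%N) => s t [s' t'].
    by apply/eqP; rewrite eq_complex /=; apply/andP; split; apply/eqP; ring.
  (* The recurrence rewrites $\gamma_{13}$ as $-a\gamma_{11}-b\gamma_{20}$, and
     $\gamma_{20}+\gamma_{02}=2\operatorname{Re}\gamma_{20}$. *)
  have LzhE' : Lambda omega (pz * h) =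
      - (omega 2%N 2%N + (2 * b * complex.Re (omega 2%N 0%N))%:C
          + (a - b)%:C * omega 1%N 1%N).
    rewrite LzhE (omega_rec 1%N 0%N isT) -(omega_conj 2%N 0%N isT).
    case: (omega 2%N 0%N) (omega 1%N 1%N) (omega 2%N 2%N) => s t [s' t'] [u v].
    by apply/eqP; rewrite eq_complex /=; apply/andP; split; apply/eqP; ring.
  rewrite LhE' LzhE'; split=> [[[/eqP] ]|[-> ->]].
    rewrite mulf_eq0 pnatr_eq0 /= subr_eq0 => /eqP -> /eqP.
    by rewrite oppr_eq0 => /eqP ->.
  by rewrite subrr mulr0 oppr0.
have iii_v : (Lambda omega h = 0 /\ Lambda omega (pz * h) = 0) ->
    h \in charpolys gamma.
  rewrite LhE LzhE => -[Lh0 Lzh0]; apply/(charpolysE _ hE).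
  by apply: (h_moments_eq0 _ gamma_rec); rewrite ?gamma_omega.
have charpolys_omega : h \in charpolys gamma -> forall i j, (i + j <= 3)%N ->
    omega i.+1 j.+2 - omega i.+2 j.+1 - b%:C * omega i j.+1
      + b%:C * omega i.+1 j = 0.
  move=> /(charpolysE _ hE) H i j ij.
  by have := H i j; rewrite !gamma_omega //; lia.
have v_vi : h \in charpolys gamma ->
    moment_col omega (isT : (1 + 2 <= 3)%N)
         - moment_col omega (isT : (2 + 1 <= 3)%N)
         - b%:C *: moment_col omega (isT : (0 + 1 <= 3)%N)
         + b%:C *: moment_col omega (isT : (1 + 0 <= 3)%N) = 0.
  move=> /charpolys_omega H; apply/colP => k.
  have [k' [l [kl ->]]] := enum_rank_MonoP k.
  have colE (u v w t : 'cV[R[i]]_#|mono 3|) i :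
      (u - v - b%:C *: w + b%:C *: t) i 0 =
      u i 0 - v i 0 - b%:C * w i 0 + b%:C * t i 0 by rewrite !mxE.
  rewrite colE !moment_colE [RHS]mxE.
  by rewrite addnC in kl; exact: H.
have vi_iii : moment_col omega (isT : (1 + 2 <= 3)%N)
         - moment_col omega (isT : (2 + 1 <= 3)%N)
         - b%:C *: moment_col omega (isT : (0 + 1 <= 3)%N)
         + b%:C *: moment_col omega (isT : (1 + 0 <= 3)%N) = 0 ->
    Lambda omega h = 0 /\ Lambda omega (pz * h) = 0.
  move=> col0.
  have colE (u v w t : 'cV[R[i]]_#|mono 3|) i :
      u - v - b%:C *: w + b%:C *: t = 0 ->
      u i 0 - v i 0 - b%:C * w i 0 + b%:C * t i 0 = 0.
    by move=> /matrixP/(_ i 0); rewrite !mxE.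
  (* Row $1$ of the column relation is the value at [h]; row $\bar z$ is the value at [pz * h]. *)
  rewrite LhE LzhE; split.
    have := colE _ _ _ _ (enum_rank (Mono (isT : 0 + 0 <= 3)%N)) col0.
    by rewrite !moment_colE.
  have := colE _ _ _ _ (enum_rank (Mono (isT : 1 + 0 <= 3)%N)) col0.
  by rewrite !moment_colE.
have iii_ii : (Lambda omega h = 0 /\ Lambda omega (pz * h) = 0) ->
    exists mu : {measure set (borelC R) -> \bar R},
      represents mu (fun _ _ => True) gamma.
  move=> /iii_iv [g12 g22].
  have gM : moment_mx 3 gamma = moment_mx 3 omega.
    apply/matrixP => r c; rewrite !mxE.
    case: (enum_val r) (enum_val c) => [[k l] kl] [[i j] ij] /=.
    by apply: gamma_omega; move: kl ij => /=; lia.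
  apply: (moment_sequence_represented ltb lta gamma_conj gamma_rec).
  - by rewrite !gamma_omega.
  - by rewrite !gamma_omega.
  - by rewrite gM.
have ii_i : (exists mu : {measure set (borelC R) -> \bar R},
      represents mu (fun _ _ => True) gamma) ->
    exists mu : {measure set (borelC R) -> \bar R},
      represents mu (fun i j => (i + j <= 6)%N) omega.
  move=> [mu mu_gamma]; exists mu => i j ij.
  by rewrite -gamma_omega //; exact: mu_gamma.
(* The cycle from (i) to (vi) and back is closed by passing through (iii) where needed. *)
tfae.
- by move=> /i_iii/iii_ii.
- by move=> /ii_i/i_iii.
- by move=> /iii_iv.
- by move=> /iii_iv/iii_v.
- exact: v_vi.
- by move=> /vi_iii/iii_ii/ii_i.
Qed.
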